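(* Let $\mathbb{V}=U\oplus W$ be a finite-dimensional vector space over a field $\mathcal{F}$, where $U$ and $W$ are nonzero subspaces and $\dim(\mathbb{V})>1$, and let $\Gamma_{U\oplus W}(\mathbb{V})$ be the direct sum graph (defined in the context). Then $\Gamma_{U\oplus W}(\mathbb{V})$ is connected and $\operatorname{diam}(\Gamma_{U\oplus W}(\mathbb{V}))=2$ if $\dim(\mathbb{V})\geq 3$. If $\dim(\mathbb{V})=2$, then $\operatorname{diam}(\Gamma_{U\oplus W}(\mathbb{V}))=1$.
   Context: Let $\mathbb{V}$ be a vector space over a field $\mathcal{F}$ with $\mathbb{V}=U\oplus W$, where $U,W$ are nonzero subspaces, $\dim U=r$, $\dim W=s$, $r+s=n=\dim\mathbb{V}$. Fix a basis $\{\alpha_1,\dots,\alpha_r\}$ of $U$ and a basis $\{\beta_1,\dots,\beta_s\}$ of $W$; every $x\in\mathbb{V}$ is written uniquely as $x=a_1\alpha_1+\dots+a_r\alpha_r+b_1\beta_1+\dots+b_s\beta_s$ (its basic representation). The direct sum graph $\Gamma_{U\oplus W}(\mathbb{V})$ is the simple graph whose vertex set is $\{x=u+w: u\in U, w\in W, u\neq 0, w\neq 0\}$ (i.e. vectors with at least one nonzero $\alpha$-coefficient and at least one nonzero $\beta$-coefficient), in which two distinct vertices $x,y$ are adjacent iff there is an index $i$ such that the coefficient of $\alpha_i$ is nonzero in both $x$ and $y$, and there is an index $j$ such that the coefficient of $\beta_j$ is nonzero in both $x$ and $y$. The diameter is the maximum distance between two vertices.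
   Formalization: The claim that the diameter is 1 when dim(V)=2 is stated only for fields with more than two elements; over the field with two elements the graph has a single vertex and diameter 0. *)

(* Defs.v *)
From HB Require Import structures.
From mathcomp Require Import all_boot all_order all_algebra.

Set Implicit Arguments.
Unset Strict Implicit.
Unset Printing Implicit Defensive.

Import GRing.Theory.
Local Open Scope ring_scope.

(* Simple graphs, possibly infinite, whose vertices are the elements of the
   carrier satisfying [vertex]. *)
Record sgraph (T : Type) := SGraph {
  vertex : T -> Prop;
  adj : T -> T -> Prop;
  adj_vertex : forall x y, adj x y -> vertex x;
  adj_sym : forall x y, adj x y -> adj y x;
  adj_irrefl : forall x, ~ adj x x }.

Inductive walk (T : Type) (G : sgraph T) : nat -> T -> T -> Prop :=
| walk0 x : vertex G x -> walk G 0 x x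
| walkS n x y z : adj G x y -> walk G n y z -> walk G n.+1 x z.

(* The empty graph does not count as connected. *)
Definition connected (T : Type) (G : sgraph T) : Prop :=
  (exists x, vertex G x) /\
  (forall x y, vertex G x -> vertex G y -> exists n, walk G n x y).

Definition is_dist (T : Type) (G : sgraph T) (x y : T) (d : nat) : Prop :=
  walk G d x y /\ (forall n, walk G n x y -> (d <= n)%N).

(* [d] is the maximum of the distances: it is attained, and every pair of
   vertices has a (finite) distance that is at most [d]. *)
Definition is_diam (T : Type) (G : sgraph T) (d : nat) : Prop :=
  (exists x y, [/\ vertex G x, vertex G y & is_dist G x y d]) /\
  (forall x y, vertex G x -> vertex G y ->
     exists2 k, is_dist G x y k & (k <= d)%N).

Section DirectSumGraph.
Variables (F : fieldType) (V : vectType F) (U W : {vspace V}).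
Variables (r s : nat) (alpha : r.-tuple V) (beta : s.-tuple V).

(* Coefficients of [x] in its basic representation with respect to the
   concatenation of the two bases. *)
Definition acoef (i : 'I_r) (x : V) : F :=
  coord (cat_tuple alpha beta) (lshift s i) x.

Definition bcoef (j : 'I_s) (x : V) : F :=
  coord (cat_tuple alpha beta) (rshift r j) x.

Definition dsvertex (x : V) : Prop :=
  exists u w, [/\ u \in U, w \in W, u != 0, w != 0 & x = u + w].

Definition dsadj (x y : V) : Prop :=
  [/\ dsvertex x, dsvertex y, x <> y,
      exists i, acoef i x != 0 /\ acoef i y != 0
    & exists j, bcoef j x != 0 /\ bcoef j y != 0].

Lemma dsadj_vertex x y : dsadj x y -> dsvertex x.
Proof. by case. Qed.

Lemma dsadj_sym x y : dsadj x y -> dsadj y x.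
Proof.
case=> vx vy xy [i [ix iy]] [j [jx jy]].
by split=> //; [move/esym | exists i | exists j].
Qed.

Lemma dsadj_irrefl x : ~ dsadj x x.
Proof. by case. Qed.

Definition direct_sum_graph : sgraph V :=
  SGraph dsadj_vertex dsadj_sym dsadj_irrefl.

End DirectSumGraph.

(* Main.v *)
(* The sum of all basis vectors has full support, so it is adjacent to every
   other vertex: the diameter is at most 2. Two vectors of the form
   alpha_i + beta_j that differ in an index are distinct and not adjacent, and
   such pairs exist as soon as dim V >= 3. When dim V = 2 any two vertices have
   the same support, and c alpha_1 + beta_1 <> alpha_1 + beta_1 for c <> 1. *)
Require Import Defs.
From HB Require Import structures.
From mathcomp Require Import all_boot all_order all_algebra.

Set Implicit Arguments.
Unset Strict Implicit.
Unset Printing Implicit Defensive.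

Import GRing.Theory.
Local Open Scope ring_scope.

(** * Short walks and distances at most 2 in an arbitrary graph *)

Section Distance.
Variables (T : Type) (G : sgraph T).
Implicit Types x y z : T.

Lemma walk0_eq x y : walk G 0 x y -> x = y.
Proof. by move=> wk; inversion wk. Qed.

Lemma walk1_adj x y : walk G 1 x y -> adj G x y.
Proof.
move=> wk; inversion wk as [|n a b c axb wbc]; subst.
by rewrite -(walk0_eq wbc).
Qed.

Lemma is_dist0 x : vertex G x -> is_dist G x x 0.
Proof. by move=> vx; split=> //; apply: walk0. Qed.

Lemma is_dist1 x y : adj G x y -> is_dist G x y 1.
Proof.
move=> axy; split.
  exact: walkS axy (walk0 (adj_vertex (adj_sym axy))).
case=> [|//] /walk0_eq eq_xy.
by case: (@adj_irrefl _ G x); rewrite {2}eq_xy.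
Qed.

Lemma is_dist2 x y z : x <> y -> ~ adj G x y -> adj G x z -> adj G z y ->
  is_dist G x y 2.
Proof.
move=> neq_xy naxy axz azy; split.
  by apply: walkS axz _; case: (is_dist1 azy).
by case=> [|[|//]] => [/walk0_eq|/walk1_adj].
Qed.

End Distance.

Section DirectSumGraph.
Variables (F : fieldType) (V : vectType F) (U W : {vspace V}).
Variables (r s : nat) (alpha : r.-tuple V) (beta : s.-tuple V).
Hypotheses (dirUW : directv (U + W)) (basisU : basis_of U alpha).
Hypothesis basisW : basis_of W beta.

Local Notation acoef := (acoef alpha beta).
Local Notation bcoef := (bcoef alpha beta).
Local Notation G := (direct_sum_graph U W alpha beta).
Implicit Types (a : 'I_r -> F) (b : 'I_s -> F).

(** * Basic representations and the supports of vertices *)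

Definition basic_repr a b : V :=
  \sum_i a i *: alpha`_i + \sum_j b j *: beta`_j.

(** Directness of the sum makes the concatenation of the two bases free, so the coordinates of a
    combination are the scalars it was built from. *)
Lemma coord_basic_repr a b k :
  coord (cat_tuple alpha beta) k (basic_repr a b) =
  match split k with inl i => a i | inr j => b j end.
Proof.
have /andP[_ free_ab] := cat_basis dirUW basisU basisW.
pose c (l : 'I_(r + s)) := match split l with inl i => a i | inr j => b j end.
suff -> : basic_repr a b = \sum_l c l *: (cat_tuple alpha beta)`_l.
  by rewrite coord_sum_free.
(* Positions below [r] in the concatenation fall in [alpha]; the others fall in [beta], shifted by
   [r]. *)
rewrite big_split_ord /=; congr (_ + _); apply: eq_bigr => i _; rewrite /c.
  by rewrite (unsplitK (inl i)) nth_cat size_tuple ltn_ord.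
by rewrite (unsplitK (inr i)) nth_cat size_tuple ltnNge leq_addr addKn.
Qed.

Lemma acoef_basic_repr a b i : acoef i (basic_repr a b) = a i.
Proof. by rewrite /Defs.acoef coord_basic_repr (unsplitK (inl i)). Qed.

Lemma bcoef_basic_repr a b j : bcoef j (basic_repr a b) = b j.
Proof. by rewrite /Defs.bcoef coord_basic_repr (unsplitK (inr j)). Qed.

Lemma basis_comb_mem n (E : {vspace V}) (X : n.-tuple V) (c : 'I_n -> F) :
  basis_of E X -> \sum_i c i *: X`_i \in E.
Proof.
move=> basisE; apply: memv_suml => i _; apply: memvZ.
by apply: (basis_mem basisE); rewrite mem_nth ?size_tuple.
Qed.

Lemma basis_comb_neq0 n (E : {vspace V}) (X : n.-tuple V) (c : 'I_n -> F) i :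
  basis_of E X -> c i != 0 -> \sum_i c i *: X`_i != 0.
Proof.
by case/andP=> _ /freeP freeX; apply: contraNneq => /freeX->.
Qed.

Lemma coord_basis_neq0 n (E : {vspace V}) (X : n.-tuple V) u :
  basis_of E X -> u \in E -> u != 0 -> exists i, coord X i u != 0.
Proof.
move=> basisE Eu u_neq0; apply/existsP; apply: contraNT u_neq0 => /existsPn c0.
rewrite (coord_basis basisE Eu) big1 // => i _.
by have /negPn/eqP-> := c0 i; rewrite scale0r.
Qed.

Lemma dsvertex_basic_repr a b i j :
  a i != 0 -> b j != 0 -> dsvertex U W (basic_repr a b).
Proof.
move=> ai bj; exists (\sum_i a i *: alpha`_i), (\sum_j b j *: beta`_j).
by split=> //; [exact: basis_comb_mem | exact: basis_comb_mem | exact: basis_comb_neq0 basisU ai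
               | exact: basis_comb_neq0 basisW bj].
Qed.

(** Expanding the two components in their own bases yields the basic representation of [x], and a
    nonzero component has a nonzero coordinate. With [dsvertex_basic_repr], this identifies the
    vertices with the vectors whose support meets both bases. *)
Lemma dsvertex_coef x : dsvertex U W x ->
  (exists i, acoef i x != 0) /\ (exists j, bcoef j x != 0).
Proof.
case=> u [w [Uu Ww u0 w0 ->]].
rewrite (coord_basis basisU Uu) (coord_basis basisW Ww) -/(basic_repr _ _).
have [i ui] := coord_basis_neq0 basisU Uu u0.
have [j wj] := coord_basis_neq0 basisW Ww w0.
by split; [exists i; rewrite acoef_basic_repr
          | exists j; rewrite bcoef_basic_repr].
Qed.

(** * The universal neighbour and the upper bound 2 *)

Definition full_vec := basic_repr (fun=> 1) (fun=> 1).

Lemma dsvertex_full_vec : (0 < r)%N -> (0 < s)%N -> dsvertex U W full_vec.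
Proof.
by move=> r0 s0; apply: (@dsvertex_basic_repr _ _ (Ordinal r0) (Ordinal s0));
  rewrite oner_eq0.
Qed.

Lemma dsadj_full_vec x : dsvertex U W x -> x <> full_vec -> adj G x full_vec.
Proof.
move=> vx neq; have [[i xi] [j xj]] := dsvertex_coef vx.
(* The indices found in the support of [x] show that both bases are nonempty, hence that [full_vec]
   is a vertex. *)
split=> //; first by apply: (@dsvertex_basic_repr _ _ i j); rewrite oner_eq0.
  by exists i; rewrite acoef_basic_repr oner_eq0.
by exists j; rewrite bcoef_basic_repr oner_eq0.
Qed.

(** Neither vertex can be [full_vec], which is adjacent to every other vertex; so [full_vec] is the
    midpoint of a walk of length 2. *)
Lemma dist_nonadj x y : dsvertex U W x -> dsvertex U W y -> x <> y ->
  ~ adj G x y -> is_dist G x y 2.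
Proof.
move=> vx vy neq_xy naxy.
have neq_x : x <> full_vec.
  move=> x_full; apply: naxy; apply: adj_sym; rewrite x_full.
  by apply: dsadj_full_vec => // y_full; apply: neq_xy; rewrite y_full.
have neq_y : y <> full_vec.
  by move=> y_full; apply: naxy; rewrite y_full; apply: dsadj_full_vec.
by apply: (is_dist2 neq_xy naxy (dsadj_full_vec vx neq_x));
  apply/adj_sym/dsadj_full_vec.
Qed.

(** A common index is sought in a finite range by a boolean test on coefficients, so the case split
    holds without excluded middle. *)
Lemma adj_dec x y : dsvertex U W x -> dsvertex U W y -> x <> y ->
  adj G x y \/ ~ adj G x y.
Proof.
move=> vx vy neq_xy.
have [/existsP[i /andP[xi yi]]|ni] :=
  boolP [exists i, (acoef i x != 0) && (acoef i y != 0)]; last first.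
  right=> -[_ _ _ [i [xi yi]] _].
  by case/existsP: ni; exists i; rewrite xi.
have [/existsP[j /andP[xj yj]]|nj] :=
  boolP [exists j, (bcoef j x != 0) && (bcoef j y != 0)]; last first.
  right=> -[_ _ _ _ [j [xj yj]]].
  by case/existsP: nj; exists j; rewrite xj.
by left; split=> //; [exists i | exists j].
Qed.

Lemma dist_le2 x y : dsvertex U W x -> dsvertex U W y ->
  exists2 k, is_dist G x y k & (k <= 2)%N.
Proof.
move=> vx vy; have [<-|/eqP neq_xy] := eqVneq x y.
  by exists 0%N => //; apply: is_dist0.
have [axy|naxy] := adj_dec vx vy neq_xy.
  by exists 1%N => //; apply: is_dist1.
by exists 2%N => //; apply: dist_nonadj.
Qed.

(** * Vertices at distance 2, and dimension at least 3 *)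

Definition basis_pair (i : 'I_r) (j : 'I_s) :=
  basic_repr (fun k => (k == i)%:R) (fun k => (k == j)%:R).

Lemma dsvertex_basis_pair i j : dsvertex U W (basis_pair i j).
Proof. by apply: (@dsvertex_basic_repr _ _ i j); rewrite eqxx oner_eq0. Qed.

(** Each vector has exactly one index in its support on each side, so adjacency would force both
    [i = i'] and [j = j']. *)
Lemma dist_basis_pair i i' j j' : (i != i') || (j != j') ->
  is_dist G (basis_pair i j) (basis_pair i' j') 2.
Proof.
move=> neq; have natr_neq0 (c : bool) : (c%:R != 0 :> F) = c.
  by case: c; rewrite ?oner_eq0 ?eqxx.
have nadj : ~ adj G (basis_pair i j) (basis_pair i' j').
  case=> _ _ _ [k [+ +]] [l [+ +]].
  rewrite !acoef_basic_repr !bcoef_basic_repr !natr_neq0.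
  move=> /eqP ki /eqP ki' /eqP lj /eqP lj'.
  by rewrite -ki -ki' -lj -lj' !eqxx in neq.
apply: dist_nonadj nadj; try exact: dsvertex_basis_pair.
(* Were the two vectors equal, comparing coefficients at the index that differs would give 1 = 0. *)
move=> eq_pair; case/orP: neq => /negPf neq.
  have /eqP := congr1 (acoef i) eq_pair.
  by rewrite !acoef_basic_repr eqxx neq oner_eq0.
have /eqP := congr1 (bcoef j) eq_pair.
by rewrite !bcoef_basic_repr eqxx neq oner_eq0.
Qed.

Lemma diam2 : (0 < r)%N -> (0 < s)%N -> (3 <= r + s)%N -> is_diam G 2.
Proof.
move=> r0 s0 rs3; split; last exact: dist_le2.
have [r1|r1] := ltnP 1 r.
  exists (basis_pair (Ordinal r0) (Ordinal s0)).
  exists (basis_pair (Ordinal r1) (Ordinal s0)).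
  by split; [exact: dsvertex_basis_pair.. | apply: dist_basis_pair].
(* Here [r <= 1], so [3 <= r + s <= 1 + s] and the second index has to come from [beta]. *)
have s1 : (1 < s)%N by rewrite -(leq_add2l 1) (leq_trans rs3) // leq_add2r.
exists (basis_pair (Ordinal r0) (Ordinal s0)).
exists (basis_pair (Ordinal r0) (Ordinal s1)).
by split; [exact: dsvertex_basis_pair.. | apply: dist_basis_pair].
Qed.

(** * Dimension 2: the graph is complete *)

Lemma adj_lines x y : r = 1%N -> s = 1%N -> dsvertex U W x -> dsvertex U W y ->
  x <> y -> adj G x y.
Proof.
move=> r1 s1 vx vy neq_xy.
have [[i xi] [j xj]] := dsvertex_coef vx.
have [[i' yi] [j' yj]] := dsvertex_coef vy.
have eq_ord n (k k' : 'I_n) : n = 1%N -> k = k'.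
  by move=> n1; subst n; rewrite !ord1.
split=> //; first by exists i; rewrite xi {1}(eq_ord _ i i').
by exists j; rewrite xj {1}(eq_ord _ j j').
Qed.

Lemma dist_le1 x y : r = 1%N -> s = 1%N -> dsvertex U W x -> dsvertex U W y ->
  exists2 k, is_dist G x y k & (k <= 1)%N.
Proof.
move=> r1 s1 vx vy; have [<-|/eqP neq_xy] := eqVneq x y.
  by exists 0%N => //; apply: is_dist0.
by exists 1%N => //; apply/is_dist1/adj_lines.
Qed.

(** The scalar [c] witnesses that the field has more than two elements, which provides a second
    vertex. Over the field with two elements the only vertex would be the sum of the two basis
    vectors, and the diameter would be 0. *)
Lemma diam1 (c : F) : r = 1%N -> s = 1%N -> c != 0 -> c != 1 -> is_diam G 1.
Proof.
move=> r1 s1 c0 c1; split=> [|x y]; last exact: dist_le1.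
have r0 : (0 < r)%N by rewrite r1.
have s0 : (0 < s)%N by rewrite s1.
have vx := dsvertex_full_vec r0 s0.
have vy : dsvertex U W (basic_repr (fun=> c) (fun=> 1)).
  by apply: (@dsvertex_basic_repr _ _ (Ordinal r0) (Ordinal s0));
    rewrite ?oner_eq0.
exists full_vec, (basic_repr (fun=> c) (fun=> 1)).
split=> //; apply/is_dist1/adj_lines => // /(congr1 (acoef (Ordinal r0))).
by rewrite !acoef_basic_repr => c_eq1; rewrite c_eq1 eqxx in c1.
Qed.

End DirectSumGraph.

Theorem theorem2p1 (F : fieldType) (V : vectType F) (U W : {vspace V})
    (r s : nat) (alpha : r.-tuple V) (beta : s.-tuple V)
    (U_neq0 : U != 0%VS) (W_neq0 : W != 0%VS)
    (dirUW : directv (U + W)) (sumUW : (U + W)%VS = fullv)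
    (basisU : basis_of U alpha) (basisW : basis_of W beta)
    (dimV : (1 < \dim {: V})%N) :
  let G := direct_sum_graph U W alpha beta in
  [/\ connected G,
      (3 <= \dim {: V})%N -> is_diam G 2
    & \dim {: V} = 2%N -> (exists c : F, c != 0 /\ c != 1) -> is_diam G 1].
Proof.
move=> G.
have dimE : \dim {: V} = (r + s)%N.
  by rewrite -sumUW (directvP dirUW) /= (size_basis basisU)
    (size_basis basisW).
have r0 : (0 < r)%N by rewrite -(size_basis basisU) lt0n dimv_eq0.
have s0 : (0 < s)%N by rewrite -(size_basis basisW) lt0n dimv_eq0.
rewrite dimE; split=> [|rs3|rs2 [c [c0 c1]]].
- split.
    by exists (full_vec alpha beta); apply: dsvertex_full_vec.
  move=> x y vx vy.
  by have [k [wk _] _] := dist_le2 dirUW basisU basisW vx vy; exists k.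
- exact: diam2.
- apply: diam1 c0 c1 => //.
    (* Adding [s] to both sides turns [r <= 1] into [2 <= 1 + s], which is [0 < s]; the bound on [s]
       is symmetric. *)
    by apply/eqP; rewrite eqn_leq r0 andbT -(leq_add2r s) rs2.
  by apply/eqP; rewrite eqn_leq s0 andbT -(leq_add2l r) rs2 addn1.
Qed.
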